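(* Let $q$ be a prime power. Identify the points of $\ell_\infty=\{(x,y,0)\}$ in $\mathrm{PG}(2,q^3)$ with $\mathrm{GF}(q^3)\cup\{\infty\}$ via $(a,1,0)\leftrightarrow a$ and $(1,0,0)\leftrightarrow\infty$. Then every tangent splash of $\ell_\infty$ is a Sherk surface of size $q^2+1$.
   Context: An order-$q$-subplane of $\mathrm{PG}(2,q^3)$ is a subplane of order $q$. If $\pi$ is an order-$q$-subplane meeting $\ell_\infty$ in exactly one point $T$, its tangent splash is the set of $q^2+1$ points of $\ell_\infty$ lying on the extension of some line of $\pi$. Sherk surfaces: for $\theta,\phi\in\mathrm{GF}(q)$ and $K,L\in\mathrm{GF}(q^3)$, the Sherk surface $\mathscr{S}(\theta,K,L,\phi)$ is the set of $X\in\mathrm{GF}(q^3)\cup\{\infty\}$ satisfying $\theta X^{1+q+q^2}+(KX^{1+q}+K^qX^{q+q^2}+K^{q^2}X^{1+q^2})+(LX+L^qX^q+L^{q^2}X^{q^2})+\phi=0$, where $\infty$ belongs to the surface exactly when the top-degree coefficient $\theta$ is $0$ (so for $\theta=K=0$, $L\ne0$ it is an affine plane of $\mathrm{AG}(3,q)\cong\mathrm{GF}(q^3)$ together with $\infty$). Sherk surfaces have size $1$, $q^2-q+1$, $q^2+1$ or $q^2+q+1$. *)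

(* Defs.v *)
From HB Require Import structures.
From mathcomp Require Import all_boot all_order all_algebra.
Set Implicit Arguments.
Unset Strict Implicit.
Unset Printing Implicit Defensive.
Import VectorInternalTheory GRing.Theory.
Local Open Scope ring_scope.

#[warnings="-redundant-canonical-projection"]
HB.instance Definition _ (F : finFieldType) (vT : vectType F) :=
  [Finite of {vspace vT} by <:].

Record projective_plane (T U : finType) (inc : T -> U -> bool)
    (P : {set T}) (L : {set U}) : Prop := ProjectivePlane {
  pplane_join : forall p p', p \in P -> p' \in P -> p != p' ->
    exists! l, [/\ l \in L, inc p l & inc p' l];
  pplane_meet : forall l l', l \in L -> l' \in L -> l != l' ->
    exists! p, [/\ p \in P, inc p l & inc p l'];
  pplane_quadrangle : exists Q : {set T}, [/\ Q \subset P, #|Q| = 4%N &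
    forall l, l \in L -> (#|[set p in Q | inc p l]| <= 2)%N]
}.

Definition projective_plane_of_order n (T U : finType) (inc : T -> U -> bool)
    (P : {set T}) (L : {set U}) : Prop :=
  projective_plane inc P L /\
  forall l, l \in L -> #|[set p in P | inc p l]| = n.+1.

Section PG2.
Context {F : finFieldType}.
Local Notation V := 'rV[F]_3.

Definition is_point (U : {vspace V}) : bool := \dim U == 1%N.
Definition is_line (U : {vspace V}) : bool := \dim U == 2%N.

(* A line of the subplane is represented by its extension to PG(2, F), so L
   consists of full 2-dimensional subspaces. *)
Definition subplane_of_order n (P L : {set {vspace V}}) : Prop :=
  [/\ {in P, forall p, is_point p},
      {in L, forall l, is_line l} &
      projective_plane_of_order n (fun p l => (p <= l)%VS) P L].

Definition coords (x y z : F) : V := \row_(i < 3) [:: x; y; z]`_i.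

(* The line z = 0. *)
Definition linfty : {vspace V} := (<[(coords 1 0 0)%R]> + <[(coords 0 1 0)%R]>)%VS.

Definition tangent_to (l : {vspace V}) (P : {set {vspace V}}) : Prop :=
  #|[set p in P | (p <= l)%VS]| = 1%N.

Definition splash (l : {vspace V}) (L : {set {vspace V}}) :
    {set {vspace V}} :=
  [set p | [&& is_point p, (p <= l)%VS & [exists m in L, (p <= m)%VS]]].

(* None stands for the element "infinity". *)
Definition linfty_point (a : option F) : {vspace V} :=
  if a is Some x then <[(coords x 1 0)%R]>%VS else <[(coords 1 0 0)%R]>%VS.

End PG2.

(* GF(q) is the subfield iota(k) of F = GF(q^3). *)
Definition sherk (k F : finFieldType) (iota : {rmorphism k -> F})
    (theta : k) (K L : F) (phi : k) : {set option F} :=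
  let q := #|k| in
  [set a : option F | if a is Some X then
      iota theta * X ^+ (1 + q + q ^ 2)
      + (K * X ^+ (1 + q) + K ^+ q * X ^+ (q + q ^ 2)
         + K ^+ (q ^ 2) * X ^+ (1 + q ^ 2))
      + (L * X + L ^+ q * X ^+ q + L ^+ (q ^ 2) * X ^+ (q ^ 2))
      + iota phi == 0
    else theta == 0].

(* Main.v *)
(** Lines of the subplane are coordinatised by a frame [e_0, e_1, e_2] extracted
    from a quadrangle.  The parameters x for which <e_i + x e_j> is a point of
    the subplane form, by Menelaus' theorem, a multiplicatively closed set of q
    elements, hence the subfield GF(q); no argument on addition is needed.  It
    follows that a vector lies on some line of the subplane iff its three
    coordinates x_i are linearly dependent over GF(q), i.e. iff the Moore
    determinant det(x_i^(q^j)) vanishes.  For the vector (X, 1, 0) each x_i is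
    affine in X, and expanding the determinant along its columns gives exactly
    the equation of a Sherk surface: the coefficient symmetry is the invariance
    of the determinant under the Frobenius map, which permutes its columns
    cyclically.

    For the size, take two lines m0, m1 of the subplane through the tangent
    point T.  The subplane lines avoiding T are the joins of a point of m0 and a
    point of m1 other than T, so there are q^2 of them, and they meet the tangent
    line in distinct points. *)
Require Import Defs.
From mathcomp Require Import all_boot all_order all_algebra all_field ring zify.
Set Implicit Arguments.
Unset Strict Implicit.
Unset Printing Implicit Defensive.
Import GRing.Theory.
Local Open Scope ring_scope.

(** * Three indices *)

Lemma ord3P (Q : 'I_3 -> Prop) : Q 0 -> Q 1 -> Q 2 -> forall i, Q i.
Proof.
move=> h0 h1 h2 [[|[|[|//]]] hi].
- by rewrite (_ : Ordinal hi = 0) //; apply: val_inj.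
- by rewrite (_ : Ordinal hi = 1) //; apply: val_inj.
- by rewrite (_ : Ordinal hi = 2) //; apply: val_inj.
Qed.

Lemma ord3_other (i : 'I_3) : exists j, i != j.
Proof. by move: i; apply: ord3P; [exists 1 | exists 0 | exists 0]. Qed.

Lemma ord3_third (i j : 'I_3) : i != j -> exists2 k : 'I_3, i != k & j != k.
Proof.
move: i j; do 2![apply: ord3P] => // _;
 by [exists 0 | exists 1 | exists 2].
Qed.

Lemma sum_distinct3 (U : nmodType) (f : 'I_3 -> U) i j k : i != j -> i != k -> j != k ->
  \sum_i f i = f i + f j + f k.
Proof.
move=> ij ik jk; rewrite (bigD1 i) //= (bigD1 j) /= 1?eq_sym // (bigD1 k) /=.
  rewrite big1 ?addr0 ?addrA // => l /andP[/andP[]].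
  by move: ij ik jk; move: i j k l; do 4![apply: ord3P].
by rewrite ![k == _]eq_sym ik jk.
Qed.

Lemma sum3 (V : nmodType) (f : 'I_3 -> V) : \sum_i f i = f 0 + f 1 + f 2.
Proof.
by rewrite !big_ord_recl big_ord0 addr0 addrA; congr (_ + f _ + f _); apply: val_inj.
Qed.

Definition vec3 {T : Type} (a b c : T) (i : 'I_3) : T :=
  if i == 0 then a else if i == 1 then b else c.

(** * The Moore determinant *)

Section Cubic.
Variables (k F : finFieldType) (iota : {rmorphism k -> F}).
Local Notation q := #|k|.

(** The $q$ elements of the subfield are roots of $X^q - X$, which has degree $q$; one more root
    would be too many. *)
Lemma mem_iotaP (x : F) : reflect (exists c, x = iota c) (x ^+ q == x).
Proof.
apply: (iffP eqP) => [xq|[c ->]]; last by rewrite -rmorphXn expf_card.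
have q_gt1 : (1 < q)%N by exact: finRing_gt1.
pose r : {poly F} := 'X^q - 'X.
have sz : size r = q.+1.
  by rewrite /r size_polyDl ?size_polyXn // size_polyN size_polyX ltnS.
have r0 : r != 0 by rewrite -size_poly_eq0 sz.
pose s := [seq iota c | c <- enum k].
have us : uniq s by rewrite map_inj_uniq ?enum_uniq //; exact: fmorph_inj.
case: (boolP (x \in s)) => [/mapP[c _ ->]|xs]; first by exists c.
have := @max_poly_roots _ r (x :: s) r0.
rewrite sz /= xs us size_map -cardE ltnn.
have rt y : y ^+ q = y -> root r y.
  by move=> e; rewrite /root /r hornerD hornerN hornerXn hornerX e subrr.
have -> : all (root r) s.
  by apply/allP => y /mapP[c _ ->]; apply: rt; rewrite -rmorphXn expf_card.
by rewrite rt // => /(_ isT isT).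
Qed.

(* Multiplication by x in S permutes S, whence x ^+ #|S| = 1. *)
Lemma expf_mulr_closed (S : {set F}) (x : F) :
  0 \notin S -> {in S &, forall y z, y * z \in S} -> x \in S ->
  x ^+ #|S| = 1.
Proof.
move=> S0 SM xS.
have nz y : y \in S -> y != 0 by apply: contraTneq => ->.
have img : [set x * y | y in S] = S.
  apply/eqP; rewrite eqEcard card_imset ?leqnn ?andbT; last exact: (mulfI (nz x xS)).
  by apply/subsetP => _ /imsetP[y yS ->]; exact: SM.
have e : \prod_(y in S) y = x ^+ #|S| * \prod_(y in S) y.
  rewrite -{1}img big_imset /=; last by move=> y z _ _; apply: (mulfI (nz x xS)).
  by rewrite big_split /= prodr_const.
have P0 : \prod_(y in S) y != 0.
  by rewrite prodf_seq_neq0; apply/allP => y _; exact/implyP/nz.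
by apply: (mulIf P0); rewrite -e mul1r.
Qed.

(** The $q-1$ nonzero elements of [S] satisfy $x^{q-1} = 1$, so all of [S] is fixed by the Frobenius
    map; equal cardinality gives equality. *)
Lemma mulr_closed_eq_iota (S : {set F}) :
  0 \in S -> {in S &, forall y z, y != 0 -> z != 0 -> y * z \in S} -> #|S| = q ->
  S = [set iota c | c : k].
Proof.
move=> S0 SM cS.
have q_gt1 : (1 < q)%N by exact: finRing_gt1.
apply/eqP; rewrite eqEcard card_imset ?cS; last exact: fmorph_inj.
rewrite leqnn andbT; apply/subsetP => x xS.
suff /mem_iotaP[c ->] : x ^+ q == x by rewrite imset_f.
have [->|x0] := eqVneq x 0; first by rewrite expr0n; case: (q) q_gt1.
have := @expf_mulr_closed (S :\ 0) x.
rewrite !inE eqxx x0 xS /= => /(_ isT).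
have cS' : #|S :\ 0| = q.-1 by rewrite -cS (cardsD1 0 S) S0.
rewrite cS' => e; rewrite -(prednK (ltnW q_gt1)) exprS e ?mulr1 // => y z.
by rewrite !inE => /andP[y0 yS] /andP[z0 zS]; rewrite mulf_neq0 // SM.
Qed.

(** $q$ is a power of the characteristic of [k], which [F] shares through [iota]. *)
Lemma exprDq (x y : F) : (x + y) ^+ q = x ^+ q + y ^+ q.
Proof.
have [p pr cp] := finPcharP k.
have cF : p \in [pchar F] by rewrite (fmorph_pchar iota).
apply: exprDn_pchar.
by rewrite (eq_pnat _ (pcharf_eq cF)) (card_pprimeChar cp) pnatX pnat_id.
Qed.

Lemma exprNq (x : F) : (- x) ^+ q = - x ^+ q.
Proof.
apply/eqP; rewrite -addr_eq0 -exprDq addNr expr0n.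
by case: (q) (finRing_gt1 k).
Qed.

Lemma exprBq (x y : F) : (x - y) ^+ q = x ^+ q - y ^+ q.
Proof. by rewrite exprDq exprNq. Qed.

Lemma exprqq (x : F) : x ^+ (q ^ 2) = (x ^+ q) ^+ q.
Proof. by rewrite -mulnn exprM. Qed.

(** The $3 \times 3$ determinant with rows [x], [y], [z], written out so that [ring] can work on
    it. *)
Definition triple (x y z : 'I_3 -> F) : F :=
  x 0 * (y 1 * z 2 - y 2 * z 1) - x 1 * (y 0 * z 2 - y 2 * z 0)
  + x 2 * (y 0 * z 1 - y 1 * z 0).

Definition moore (x : 'I_3 -> F) : F :=
  triple x (fun i => x i ^+ q) (fun i => x i ^+ (q ^ 2)).

Lemma tripleq x y z :
  triple x y z ^+ q = triple (fun i => x i ^+ q) (fun i => y i ^+ q) (fun i => z i ^+ q).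
Proof. by rewrite /triple !(exprDq, exprBq, exprMn, exprNq). Qed.

Definition dependent (x : 'I_3 -> F) : Prop :=
  exists2 l : 'I_3 -> k, exists j, l j != 0 & \sum_i iota (l i) * x i = 0.

(** Raising the relation to the powers $q$ and $q^2$ fixes its coefficients, so it annihilates all
    three rows of the Moore matrix. *)
Lemma dependent_moore x : dependent x -> moore x = 0.
Proof.
case=> l [j lj] s0.
have s1 : \sum_i iota (l i) * x i ^+ q = 0.
  have := congr1 (fun t => t ^+ q) s0.
  rewrite !sum3 !exprDq !exprMn -!rmorphXn !expf_card => ->.
  by rewrite expr0n; case: (q) (finRing_gt1 k).
have s2 : \sum_i iota (l i) * x i ^+ (q ^ 2) = 0.
  have := congr1 (fun t => t ^+ q) s1.
  rewrite !sum3 !exprDq !exprMn -!rmorphXn !expf_card !exprqq => ->.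
  by rewrite expr0n; case: (q) (finRing_gt1 k).
(* Cramer's rule: [iota (l i)] times the determinant combines the three relations, with the
   cofactors of column [i] as weights. *)
suff e i : iota (l i) * moore x = 0.
  by have /eqP := e j; rewrite mulf_eq0 fmorph_eq0 (negPf lj) => /eqP.
move: s0 s1 s2; rewrite !sum3 /moore /triple.
move: i; apply: ord3P; set y := fun i => x i ^+ q; set z := fun i => x i ^+ (q ^ 2).
- move=> s0 s1 s2.
  transitivity ((iota (l 0) * x 0 + iota (l 1) * x 1 + iota (l 2) * x 2)
     * (y 1 * z 2 - y 2 * z 1)
   - (iota (l 0) * y 0 + iota (l 1) * y 1 + iota (l 2) * y 2)
     * (x 1 * z 2 - x 2 * z 1)
   + (iota (l 0) * z 0 + iota (l 1) * z 1 + iota (l 2) * z 2)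
     * (x 1 * y 2 - x 2 * y 1)).
    by rewrite /y /z /=; ring.
  by rewrite s0 s1 s2; ring.
- move=> s0 s1 s2.
  transitivity (- (iota (l 0) * x 0 + iota (l 1) * x 1 + iota (l 2) * x 2)
     * (y 0 * z 2 - y 2 * z 0)
   + (iota (l 0) * y 0 + iota (l 1) * y 1 + iota (l 2) * y 2)
     * (x 0 * z 2 - x 2 * z 0)
   - (iota (l 0) * z 0 + iota (l 1) * z 1 + iota (l 2) * z 2)
     * (x 0 * y 2 - x 2 * y 0)).
    by rewrite /y /z /=; ring.
  by rewrite s0 s1 s2; ring.
- move=> s0 s1 s2.
  transitivity ((iota (l 0) * x 0 + iota (l 1) * x 1 + iota (l 2) * x 2)
     * (y 0 * z 1 - y 1 * z 0)
   - (iota (l 0) * y 0 + iota (l 1) * y 1 + iota (l 2) * y 2)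
     * (x 0 * z 1 - x 1 * z 0)
   + (iota (l 0) * z 0 + iota (l 1) * z 1 + iota (l 2) * z 2)
     * (x 0 * y 1 - x 1 * y 0)).
    by rewrite /y /z /=; ring.
  by rewrite s0 s1 s2; ring.
Qed.

(* With u = x 1 / x 0, w = x 2 / x 0, U = u^q - u and W = w^q - w, the Moore
   determinant is U W^q - W U^q up to the nonzero factor x_0^(1+q+q^2). *)
Lemma moore_dependent x : moore x = 0 -> dependent x.
Proof.
move=> m0.
have [x0|x0] := eqVneq (x 0) 0.
  exists (vec3 1 0 0); first by exists 0; exact: oner_neq0.
  by rewrite sum3 /= x0 !rmorph0 rmorph1; ring.
pose u := x 1 / x 0; pose w := x 2 / x 0.
have xu : x 1 = u * x 0 by rewrite divfK.
have xw : x 2 = w * x 0 by rewrite divfK.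
clearbody u w.
pose U := u ^+ q - u; pose W := w ^+ q - w.
have UW : U * W ^+ q - W * U ^+ q = 0.
  have : x 0 * x 0 ^+ q * x 0 ^+ (q ^ 2) * (U * W ^+ q - W * U ^+ q) = 0.
    rewrite -m0 /moore /triple xu xw /U /W !exprBq !exprMn !exprqq.
    by move: (u ^+ q) (w ^+ q) => a b; ring.
  by move/eqP; rewrite !mulf_eq0 !expf_eq0 (negPf x0) !andbF /= => /eqP.
have [U0|U0] := eqVneq U 0.
  have /mem_iotaP[c uc] : u ^+ q == u by rewrite -subr_eq0 -/U U0.
  exists (vec3 (- c) 1 0); first by exists 1; exact: oner_neq0.
  by rewrite sum3 /= xu uc rmorphN rmorph0 rmorph1; ring.
(* The equation [UW] says that $W/U$ is fixed by the Frobenius map. Then $w - cu$ is fixed as well,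
   because its $q$-th power minus itself is $W - cU = 0$. *)
have /mem_iotaP[c cWU] : (W / U) ^+ q == W / U.
  have Uq : U ^+ q != 0 by rewrite expf_neq0.
  rewrite exprMn exprVn eqr_div // mulrC -subr_eq0; apply/eqP.
  by rewrite -UW; ring.
have WU : W = iota c * U by rewrite -cWU divfK.
have /mem_iotaP[d wd] : (w - iota c * u) ^+ q == w - iota c * u.
  rewrite exprBq exprMn -rmorphXn expf_card -subr_eq0; apply/eqP.
  by transitivity (W - iota c * U); [rewrite /W /U; ring | rewrite WU subrr].
exists (vec3 (- d) (- c) 1); first by exists 2; exact: oner_neq0.
rewrite sum3 /= xu xw !rmorphN rmorph1 -wd; ring.
Qed.

Hypothesis cardF : #|F| = (q ^ 3)%N.

Lemma exprqqq (x : F) : ((x ^+ q) ^+ q) ^+ q = x.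
Proof. by rewrite -[RHS]expf_card cardF !expnS expn0 muln1 !exprM. Qed.

Lemma triple_cycle x y z : triple x y z = triple y z x.
Proof. rewrite /triple; ring. Qed.

(** The Frobenius map permutes the three rows cyclically, an even permutation, so it fixes the
    determinant. *)
Lemma moore_in_iota x : exists c, moore x = iota c.
Proof.
apply/mem_iotaP/eqP; rewrite tripleq /moore -triple_cycle /triple !exprqq !exprqqq.
by [].
Qed.

Lemma moore_sherk (a b : 'I_3 -> F) :
  exists (theta : k) (K M : F) (phi : k), forall o : option F,
   (o \in sherk iota theta K M phi) = 
   (moore (if o is Some X then fun i => X * a i + b i else a) == 0).
Proof.
have [theta th] := moore_in_iota a; have [phi ph] := moore_in_iota b.
pose f x (i : 'I_3) : F := x i ^+ q.
(* By multilinearity these are the coefficients of $X^{1+q+q^2}$, $X^{1+q}$, $X$ and $1$. Row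
   rotation makes the remaining ones their conjugates. At infinity the condition is [moore a = 0],
   that is $\theta = 0$. *)
exists theta, (triple a (f a) (f (f b))), (triple a (f b) (f (f b))), phi.
case=> [X|]; rewrite inE; last by rewrite th fmorph_eq0.
congr (_ == 0); rewrite -th -ph !exprqq !tripleq !exprD /moore /triple /f.
rewrite !exprqq !expr1 !(exprDq, exprMn) !exprqqq; ring.
Qed.
End Cubic.

(** * Points and lines of PG(2, F) *)

Section Points.
Variable F : finFieldType.
Local Notation V := 'rV[F]_3.
Implicit Types (p l : {vspace V}) (v w : V).

Lemma vlineZ (c : F) v : c != 0 -> (<[c *: v]> = <[v]>)%VS.
Proof.
move=> c0; apply/eqP; rewrite eqEsubv -!memvE memvZ ?memv_line //=.
by apply/vlineP; exists c^-1; rewrite scalerK.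
Qed.

Lemma memv_pairP v a b :
  reflect (exists s t, v = s *: a + t *: b) (v \in <[a]> + <[b]>)%VS.
Proof.
apply: (iffP memv_addP) => [[_ /vlineP[s ->] [_ /vlineP[t ->] ->]]|[s [t ->]]].
  by exists s, t.
by exists (s *: a); rewrite ?memvZ ?memv_line //; exists (t *: b); rewrite ?memvZ ?memv_line.
Qed.

Lemma point_vline p : is_point p -> exists2 v, v != 0 & p = <[v]>%VS.
Proof.
move=> /eqP dp; have v0 : vpick p != 0 by rewrite vpick0 -dimv_eq0 dp.
exists (vpick p) => //; apply/esym/eqP.
by rewrite eqEdim -memvE memv_pick dp dim_vline v0.
Qed.

Lemma is_point_vline v : is_point <[v]>%VS = (v != 0).
Proof. by rewrite /is_point dim_vline eqb1. Qed.

Lemma point_sub_eq p p' : is_point p -> is_point p' -> (p <= p')%VS -> p = p'.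
Proof. by move=> /eqP dp /eqP dp' s; apply/eqP; rewrite eqEdim s dp dp'. Qed.

Lemma line_sub_eq l l' : is_line l -> is_line l' -> (l <= l')%VS -> l = l'.
Proof. by move=> /eqP dp /eqP dp' s; apply/eqP; rewrite eqEdim s dp dp'. Qed.

Lemma is_line_join p p' : is_point p -> is_point p' -> p != p' -> is_line (p + p')%VS.
Proof.
move=> ip ip' ne; rewrite /is_line.
have := dimv_sum_cap p p'; have := dimvS (capvSl p p').
rewrite (eqP ip) (eqP ip') => d1 ds.
have : \dim (p :&: p') != 1%N.
  apply: contra ne => d; apply/eqP.
  by rewrite -(point_sub_eq d ip (capvSl _ _)) (point_sub_eq d ip' (capvSr _ _)).
by move: d1 ds; lia.
Qed.

(** The sum has dimension at most 3, so the meet has dimension at least 1; dimension 2 would make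
    the lines equal. *)
Lemma is_point_meet l l' : is_line l -> is_line l' -> l != l' -> is_point (l :&: l')%VS.
Proof.
move=> il il' ne; rewrite /is_point.
have := dimv_sum_cap l l'; have := dimvS (capvSl l l').
have := dimvS (subvf (l + l')); rewrite dimvf dim_matrix.
rewrite (eqP il) (eqP il') => d3 d1 ds.
have : \dim (l :&: l') != 2%N.
  apply: contra ne => d; apply/eqP.
  by rewrite -(line_sub_eq d il (capvSl _ _)) (line_sub_eq d il' (capvSr _ _)).
by move: d1 d3 ds; lia.
Qed.

Lemma meet_eq p l l' : is_point p -> is_line l -> is_line l' -> l != l' ->
  (p <= l)%VS -> (p <= l')%VS -> (l :&: l')%VS = p.
Proof.
move=> ip il il' ne pl pl'; apply/esym/point_sub_eq => //; first exact: is_point_meet.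
by rewrite subv_cap pl.
Qed.

Lemma join_eq p p' l : is_point p -> is_point p' -> is_line l -> p != p' ->
  (p <= l)%VS -> (p' <= l)%VS -> (p + p')%VS = l.
Proof.
move=> ip ip' il ne pl pl'; apply: line_sub_eq => //; first exact: is_line_join.
by rewrite subv_add pl.
Qed.

Lemma indep_coef0 (a b : F) (u v w : V) c :
  u \notin (<[v]> + <[w]>)%VS -> c *: u + a *: v + b *: w = 0 -> c = 0.
Proof.
move=> nu e; apply/eqP; apply: contraNT nu => c0; apply/memv_pairP.
exists (- a / c), (- b / c); apply: (scalerI c0).
rewrite scalerDr !scalerA !(mulrC c) !divfK //.
by rewrite !scaleNr -opprD; apply/eqP; rewrite -addr_eq0 addrA e.
Qed.
End Points.

(** * Coordinates with respect to a basis of row vectors *)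

Section Coordinates.
Variables (F : finFieldType) (E : 'M[F]_3).
Hypothesis uE : E \in unitmx.
Local Notation V := 'rV[F]_3.
Local Notation e i := (row i E).

Definition crd (v : V) (i : 'I_3) : F := (v *m invmx E) 0 i.

Lemma crdD v w i : crd (v + w) i = crd v i + crd w i.
Proof. by rewrite /crd mulmxDl mxE. Qed.

Lemma crdZ c v i : crd (c *: v) i = c * crd v i.
Proof. by rewrite /crd -scalemxAl mxE. Qed.

Lemma crd0 i : crd 0 i = 0.
Proof. by rewrite /crd mul0mx mxE. Qed.

Lemma crd_row j i : crd (e j) i = (j == i)%:R.
Proof. by rewrite /crd rowE -mulmxA mulmxV // mulmx1 mxE eqxx eq_sym. Qed.

Lemma crd_sum v : v = \sum_i crd v i *: e i.
Proof. by rewrite -mulmx_sum_row mulmxKV. Qed.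

Definition crdE := (crdD, crdZ, crd_row, crd0).
End Coordinates.

(** * Frames *)

Section Subplane.
Variables (F : finFieldType) (n : nat) (P L : {set {vspace 'rV[F]_3}}).
Hypothesis hsub : subplane_of_order n P L.
Local Notation V := 'rV[F]_3.
Implicit Types (p l : {vspace V}) (v w : V).

Lemma subplane_point p : p \in P -> is_point p. Proof. by case: hsub => h _ _; exact: h. Qed.
Lemma subplane_line l : l \in L -> is_line l. Proof. by case: hsub => _ h _; exact: h. Qed.

(** The line given by the subplane axiom is a full line of the ambient plane, hence equal to the
    span of the two points. *)
Lemma join_in p p' : p \in P -> p' \in P -> p != p' -> (p + p')%VS \in L.
Proof.
move=> pP p'P ne; case: (hsub) => _ _ [pl _].
have [l [[lL pl1 pl2] _]] := pplane_join pl pP p'P ne.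
by rewrite (join_eq _ _ (subplane_line lL) ne) // subplane_point.
Qed.

Lemma meet_in l l' : l \in L -> l' \in L -> l != l' -> (l :&: l')%VS \in P.
Proof.
move=> lL l'L ne; case: (hsub) => _ _ [pl _].
have [p [[pP pl1 pl2] _]] := pplane_meet pl lL l'L ne.
by rewrite (meet_eq _ (subplane_line lL) _ ne pl1 pl2) ?subplane_line // subplane_point.
Qed.

(** The vector [v] only certifies that the two lines differ, so that their meet is spanned by
    [w]. *)
Lemma vline_meet v w l l' : l \in L -> l' \in L -> v \in l -> v \notin l' ->
  w != 0 -> w \in l -> w \in l' -> (<[w]>)%VS \in P.
Proof.
move=> lL l'L vl vl' w0 wl wl'.
have ne : l != l' by apply: contraNneq vl' => <-.
rewrite -(@meet_eq _ <[w]>%VS _ _ _ (subplane_line lL) (subplane_line l'L) ne) ?meet_in //.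
by rewrite is_point_vline.
Qed.

Lemma vlines_join v w : (<[v]>)%VS \in P -> (<[w]>)%VS \in P -> w \notin (<[v]>)%VS ->
  (<[v]> + <[w]>)%VS \in L.
Proof.
by move=> vP wP nw; apply: join_in => //; apply: contraNneq nw => ->; rewrite memv_line.
Qed.

Lemma quadrangle_noncollinear (Q : {set {vspace V}}) p p' p'' :
  Q \subset P -> (forall l, l \in L -> #|[set p in Q | (p <= l)%VS]| <= 2)%N ->
  [&& p \in Q, p' \in Q & p'' \in Q] -> uniq [:: p; p'; p''] -> ~~ (p <= p' + p'')%VS.
Proof.
move=> /subsetP QP Q2 /and3P[pQ p'Q p''Q] u; apply/negP => s.
have ne : p' != p'' by move: u; rewrite /= !inE andbT => /andP[].
have := Q2 _ (join_in (QP _ p'Q) (QP _ p''Q) ne).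
rewrite leqNgt => /negP[].
have c3 : #|[set:: [:: p; p'; p'']]| = 3%N by rewrite cardsE (card_uniqP u).
apply: (leq_trans (eq_leq (esym c3))); apply/subset_leq_card/subsetP => x; rewrite !inE.
by case/or3P => /eqP->; rewrite ?pQ ?p'Q ?p''Q ?s ?addvSl ?addvSr.
Qed.

(** The points [row i E + row j E] are the projections of the unit point from the vertices onto the
    opposite sides. *)
Definition frame (E : 'M[F]_3) : Prop :=
  [/\ E \in unitmx, forall i, (<[row i E]>)%VS \in P &
      forall i j, i != j -> (<[row i E + row j E]>)%VS \in P].

Lemma noncollinear_unitmx (M : 'M[F]_3) :
  (forall i j k : 'I_3, i != j -> i != k -> j != k ->
     row i M \notin (<[row j M]> + <[row k M]>)%VS) -> M \in unitmx.
Proof.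
move=> nc; rewrite -row_free_unit -kermx_eq0; apply/rowV0P => c /sub_kermxP cM.
apply/rowP => i; rewrite mxE.
have [j ij] : exists j, i != j by exact: ord3_other.
have [k ik jk] := ord3_third ij.
apply: (indep_coef0 (a := c 0 j) (b := c 0 k) (nc i j k ij ik jk)).
by rewrite -cM mulmx_sum_row (sum_distinct3 _ ij ik jk).
Qed.

(** Three points of a quadrangle serve as vertices; their vectors are rescaled so that the fourth
    point becomes the sum of all three. *)
Lemma exists_frame : exists E, frame E.
Proof.
have [Q [QP cQ Q2]] : exists Q : {set {vspace V}}, [/\ Q \subset P, #|Q| = 4%N &
    forall l, l \in L -> (#|[set p in Q | (p <= l)%VS]| <= 2)%N].
  by case: (hsub) => _ _ [pl _]; exact: (pplane_quadrangle pl).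
have nc p p' p'' := @quadrangle_noncollinear Q p p' p'' QP Q2.
move: (mem_enum Q) (enum_uniq Q); rewrite cardE in cQ.
case: (enum Q) cQ => [|p0 [|p1 [|p2 [|d []]]]] // _ mQ uQ.
have QPd p : p \in [:: p0; p1; p2; d] -> p \in P.
  by rewrite mQ; exact: (subsetP QP).
have ncd p p' p'' :
    [&& p \in [:: p0; p1; p2; d], p' \in [:: p0; p1; p2; d]
      & p'' \in [:: p0; p1; p2; d]] ->
    uniq [:: p; p'; p''] -> ~~ (p <= p' + p'')%VS.
  by rewrite !mQ; exact: nc.
have dm : d \in [:: p0; p1; p2; d] by rewrite !inE eqxx !orbT.
have [u3 u30 ed] := point_vline (subplane_point (QPd d dm)).
pose p := vec3 p0 p1 p2.
have pm i : p i \in [:: p0; p1; p2].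
  by move: i; apply: ord3P; rewrite !inE eqxx ?orbT.
have pinj i j : i != j -> p i != p j.
  move: uQ; rewrite /= !inE !negb_or -!andbA => /and5P[a b _ c _].
  by move: i j; do 2![apply: ord3P] => // _; rewrite // eq_sym.
have pm' i : p i \in [:: p0; p1; p2; d].
  by move: (pm i); rewrite !inE => /or3P[] ->; rewrite ?orbT.
have pd i : p i != d.
  apply: contraTneq (pm i) => ->.
  by move: uQ; rewrite -[[:: _, _, _, _ & _]]/(rcons [:: p0; p1; p2] d) rcons_uniq => /andP[].
pose M : 'M[F]_3 := \matrix_i vpick (p i).
have pM i : p i = <[row i M]>%VS.
  rewrite rowK; apply/eqP; rewrite eq_sym eqEdim -memvE memv_pick.
  rewrite dim_vline vpick0 -dimv_eq0.
  by rewrite (eqP (subplane_point (QPd _ (pm' i)))).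
have uM : M \in unitmx.
  apply: noncollinear_unitmx => i j k ij ik jk; rewrite memvE -!pM; apply: ncd.
    by rewrite !pm'.
  by rewrite /= !inE !negb_or !pinj.
(* A zero coordinate would put the fourth point on a side of the triangle. *)
have a0 i : crd M u3 i != 0.
  have [j ij] : exists j, i != j by exact: ord3_other.
  have [k ik jk] := ord3_third ij.
  have : u3 \notin (<[row j M]> + <[row k M]>)%VS.
    rewrite memvE -ed -!pM; apply: ncd; first by rewrite dm !pm'.
    by rewrite /= !inE !negb_or ![d == _]eq_sym !pd pinj.
  apply: contraNneq => ci; apply/memv_pairP; exists (crd M u3 j), (crd M u3 k).
  by rewrite {1}(crd_sum uM u3) (sum_distinct3 _ ij ik jk) ci scale0r add0r.
pose E := \matrix_i (crd M u3 i *: row i M).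
have rE i : row i E = crd M u3 i *: row i M by rewrite rowK.
have eE i : <[row i E]>%VS = p i by rewrite rE vlineZ // pM.
have uE : E \in unitmx.
  apply: noncollinear_unitmx => i j k ij ik jk; rewrite memvE !eE; apply: ncd.
    by rewrite !pm'.
  by rewrite /= !inE !negb_or !pinj.
exists E; split=> // [i|i j ij]; first by rewrite eE QPd.
have [k ik jk] := ord3_third ij.
have u3E : u3 = row i E + row j E + row k E.
  by rewrite {1}(crd_sum uM u3) (sum_distinct3 _ ij ik jk) !rE.
have l1 : (<[row i E]> + <[row j E]>)%VS \in L by rewrite !eE join_in ?QPd // pinj.
have l2 : (<[u3]> + <[row k E]>)%VS \in L.
  by rewrite !eE -ed join_in ?QPd // eq_sym pd.
(* [row i E + row j E] equals [u3 - row k E], so it lies on the side and on the join of the fourth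
   point with the third vertex. *)
apply: (@vline_meet (row k E) _ _ _ l2 l1).
- by rewrite memvE addvSr.
- rewrite memvE !eE; apply: ncd; rewrite ?pm' //=.
  by rewrite !inE !negb_or ![p k == _]eq_sym !pinj.
- apply/eqP => /(congr1 (fun v => crd E v i)).
  by rewrite !crdE // eqxx eq_sym (negPf ij) addr0 => /eqP; rewrite oner_eq0.
- apply/memv_pairP; exists 1, (-1); rewrite u3E scale1r scaleN1r addrK //.
- by apply: memv_add; rewrite memv_line.
Qed.
End Subplane.

(** * Coordinates over the subfield *)

Section Framed.
Variables (k F : finFieldType) (iota : {rmorphism k -> F}).
Variables (P L : {set {vspace 'rV[F]_3}}).
Hypothesis hsub : subplane_of_order #|k| P L.
Variable E : 'M[F]_3.
Hypothesis fE : frame P E.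
Local Notation V := 'rV[F]_3.
Local Notation e i := (row i E).

Let uE : E \in unitmx. Proof. by case: fE. Qed.
Let eP i : (<[e i]>)%VS \in P. Proof. by case: fE. Qed.

Lemma frame_pair_crd i j v : v \in (<[e i]> + <[e j]>)%VS ->
  forall l, l != i -> l != j -> crd E v l = 0.
Proof.
move=> /memv_pairP[s [t ->]] l li lj.
by rewrite !crdE // ![_ == l]eq_sym (negPf li) (negPf lj) !mulr0 addr0.
Qed.

Lemma frame_join i j : i != j -> (<[e i]> + <[e j]>)%VS \in L.
Proof.
move=> ij; apply: (vlines_join hsub) => //; apply/vlineP => -[c].
move/(congr1 (fun v => crd E v j)); rewrite !crdE // eqxx (negPf ij) mulr0.
by move/eqP; rewrite oner_eq0.
Qed.

(** The new vector is $(e_i + x e_j) - x(e_j + y e_l)$: the line through the two given points cuts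
    the third side there. *)
Lemma menelaus i j l x y : i != j -> i != l -> j != l ->
  (<[e i + x *: e j]>)%VS \in P -> (<[e j + y *: e l]>)%VS \in P ->
  (<[e i + - (x * y) *: e l]>)%VS \in P.
Proof.
move=> ij il jl pP qP.
have mL : (<[e i + x *: e j]> + <[e j + y *: e l]>)%VS \in L.
  apply: (vlines_join hsub) => //; apply/vlineP => -[c h].
  have := congr1 (fun v => crd E v i) h; rewrite !crdE // eqxx.
  rewrite ![_ == i]eq_sym (negPf ij) (negPf il).
  rewrite !mulr0 !addr0 mulr1 => c0.
  have := congr1 (fun v => crd E v j) h; rewrite -c0 scale0r !crdE // eqxx.
  rewrite eq_sym (negPf jl).
  by rewrite mulr0 addr0 => /eqP; rewrite oner_eq0.
apply: (@vline_meet _ _ _ _ hsub (e j + y *: e l) _ _ _ mL (frame_join il)).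
- by rewrite memvE addvSr.
- apply/negP => /frame_pair_crd /(_ j); rewrite eq_sym ij jl => /(_ isT isT)/eqP.
  by rewrite !crdE // eqxx (eq_sym l) (negPf jl) mulr0 addr0 oner_eq0.
- apply/eqP => /(congr1 (fun v => crd E v i)); rewrite !crdE // eqxx eq_sym (negPf il).
  by rewrite mulr0 addr0 => /eqP; rewrite oner_eq0.
- apply/memv_pairP; exists 1, (- x); rewrite scale1r scalerDr scalerA !scaleNr mulNr scaleNr.
  by rewrite addrA addrK.
- by apply/memv_pairP; exists 1, (- (x * y)); rewrite scale1r.
Qed.

(* The unit point makes e_a + e_b a point for all a <> b, and Menelaus with
   these carries the parameter of a point from one side to the next. *)
Lemma side_shift i j l y : i != j -> i != l -> j != l ->
  (<[e i + y *: e j]>)%VS \in P -> (<[e j + y *: e l]>)%VS \in P.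
Proof.
move=> ij il jl h0.
have u a b : a != b -> (<[e a + 1 *: e b]>)%VS \in P.
  by case: fE => _ _ h ab; rewrite scale1r h.
have [ji li lj] : [/\ j != i, l != i & l != j] by split; rewrite eq_sym.
(* The parameter passes to the sides [l j], [l i], [j i], [j l] with values $-y, y, -y, y$, so four
   applications cancel the signs. *)
have h1 := menelaus li lj ij (u _ _ li) h0.
have h2 := menelaus lj li ji h1 (u _ _ ji).
have h3 := menelaus jl ji li (u _ _ jl) h2.
have := menelaus ji jl il h3 (u _ _ il).
by rewrite !(mul1r, mulr1, opprK).
Qed.

(** After [y] is shifted to side [j l], Menelaus puts $-xy$ on side [i l]; a second use with $e_l +
    e_j$ returns $xy$ to side [i j]. *)
Lemma side_mul i j x y : i != j ->
  (<[e i + x *: e j]>)%VS \in P -> (<[e i + y *: e j]>)%VS \in P ->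
  (<[e i + (x * y) *: e j]>)%VS \in P.
Proof.
move=> ij hx hy; have [l il jl] := ord3_third ij.
have [ji li lj] : [/\ j != i, l != i & l != j] by split; rewrite eq_sym.
have u : (<[e l + 1 *: e j]>)%VS \in P by case: fE => _ _ h; rewrite scale1r h.
have := menelaus ij il jl hx (side_shift ij il jl hy).
by move=> /(fun h => menelaus il ij lj h u); rewrite mulr1 opprK.
Qed.

Definition side_params i j : {set F} := [set x | (<[e i + x *: e j]>)%VS \in P].

(** The side carries $q+1$ subplane points, and each except $e_j$ is $e_i + x e_j$ for exactly one
    $x$. *)
Lemma card_side_params i j : i != j -> #|side_params i j| = #|k|.
Proof.
move=> ij; have := frame_join ij; set l := (_ + _)%VS => lL.
have cl : #|[set p in P | (p <= l)%VS]| = #|k|.+1 by case: hsub => _ _ [_]; apply.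
pose f x := (<[e i + x *: e j]>)%VS.
have fi x : crd E (e i + x *: e j) i = 1.
  by rewrite !crdE // eqxx eq_sym (negPf ij) mulr0 addr0.
have finj : injective f.
  move=> x y xy; have : e i + x *: e j \in f y by rewrite -xy memv_line.
  case/vlineP => c h; have := congr1 (fun v => crd E v i) h.
  rewrite /= crdZ !fi mulr1 => c1; move: h; rewrite -c1 scale1r => /addrI h.
  have := congr1 (fun v => crd E v j) h.
  by rewrite /= !crdZ crd_row // eqxx !mulr1.
have nf : <[e j]>%VS \notin f @: side_params i j.
  apply/negP => /imsetP[x _ h].
  have : e i + x *: e j \in <[e j]>%VS by rewrite h memv_line.
  case/vlineP => c /(congr1 (fun v => crd E v i)).
  by rewrite /= fi !crdE // eq_sym (negPf ij) mulr0 => /eqP; rewrite oner_eq0.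
have : [set p in P | (p <= l)%VS] = <[e j]>%VS |: f @: side_params i j.
  apply/setP => p; rewrite !inE; apply/andP/orP => [[pP pl]|[/eqP->|/imsetP[x]]].
  - have [v v0 pv] := point_vline (subplane_point hsub pP).
    move: pl; rewrite pv -memvE => /memv_pairP[s [t ve]].
    have [s0|s0] := eqVneq s 0.
      move: v0; rewrite ve s0 scale0r add0r => v0; left.
      by rewrite vlineZ //; apply: contraNneq v0 => ->; rewrite scale0r.
    have h : <[v]>%VS = f (t / s).
      by rewrite /f -(vlineZ _ s0) scalerDr scalerA mulrC divfK // -ve.
    by right; rewrite h imset_f // inE -/(f _) -h -pv.
  - by rewrite eP addvSr.
  - rewrite inE => hx ->; split=> //; rewrite -memvE.
    by apply/memv_pairP; exists 1, x; rewrite scale1r.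
move=> h; move: cl; rewrite h cardsU1 nf card_imset // add1n; exact: succn_inj.
Qed.

Lemma sideP i j x : i != j ->
  reflect (exists c, x = iota c) ((<[e i + x *: e j]>)%VS \in P).
Proof.
move=> ij; have -> : ((<[e i + x *: e j]>)%VS \in P) = (x \in side_params i j).
  by rewrite inE.
rewrite (mulr_closed_eq_iota iota _ _ (card_side_params ij)).
- by apply: (iffP imsetP) => -[c]; [exists c | exists c].
- by rewrite inE scale0r addr0.
- by move=> y z; rewrite !inE => hy hz _ _; exact: side_mul.
Qed.

(** A line of the subplane is recovered from its meets with two sides through a vertex off it; these
    have the form $e_i + c_i e_j$ with $c_i$ in the subfield. *)
Lemma on_lineP v :
  (exists2 m, m \in L & v \in m) <-> dependent iota (crd E v).
Proof.
split=> [[m mL vm]|[l [j lj] s0]].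
- have im := subplane_line hsub mL.
  have [j ej] : exists j, e j \notin m.
    apply/existsP; rewrite -negb_forall; apply/negP => /forallP h.
    have : ({:V} <= m)%VS.
      apply/subvP => w _; rewrite (crd_sum uE w).
      by apply: memv_suml => i _; rewrite memvZ.
    by move/dimvS; rewrite dimvf dim_matrix (eqP im).
  (* The value at [j] is a dummy 0. The other values are the parameters of the points where [m]
     meets the sides through $e_j$. *)
  have [c hc] : exists c : 'I_3 -> k, forall i, i != j -> e i + iota (c i) *: e j \in m.
    apply: (@fin_all_exists _ _ (fun i c => i != j -> e i + iota c *: e j \in m)) => i.
    have [->|ij] := eqVneq i j; first by exists 0.
    have sL := frame_join ij.
    have ne : (<[e i]> + <[e j]>)%VS != m.
      by apply: contraNneq ej => <-; rewrite memvE addvSr.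
    have := meet_in hsub sL mL ne; set p := (_ :&: _)%VS => pP.
    have [w w0 pw] := point_vline (subplane_point hsub pP).
    have : w \in p by rewrite pw memv_line.
    rewrite memv_cap => /andP[/memv_pairP[s [t we]] wm].
    have s0 : s != 0.
      apply: contraNneq ej => s0; move: w0 wm; rewrite we s0 scale0r add0r => w0.
      have t0 : t != 0 by apply: contraNneq w0 => ->; rewrite scale0r.
      by rewrite !memvE vlineZ.
    have h : <[w]>%VS = <[e i + (t / s) *: e j]>%VS.
      by rewrite -(vlineZ (e i + _) s0) scalerDr scalerA mulrC divfK // -we.
    have /(sideP _ ij)[c hc] : <[e i + (t / s) *: e j]>%VS \in P by rewrite -h -pw.
    by exists c => _; rewrite -hc memvE -h -memvE.
  exists (fun i => if i == j then 1 else - c i).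
    by exists j; rewrite eqxx oner_neq0.
  (* Subtracting from [v] the points on the sides, weighted by its coordinates, leaves a multiple of
     $e_j$ in [m]; its factor must vanish since $e_j$ is not in [m]. *)
  apply/eqP; apply: contraNT ej => d0.
  rewrite memvE -(vlineZ _ d0) -memvE.
  suff -> : (\sum_i iota (if i == j then 1 else - c i) * crd E v i) *: e j =
      v - \sum_(i | i != j) crd E v i *: (e i + iota (c i) *: e j).
    by apply: memvB => //; apply: memv_suml => i ij; rewrite memvZ ?hc.
  rewrite {2}(crd_sum uE v) (bigD1 j) //= eqxx rmorph1 mul1r.
  rewrite [in RHS](bigD1 j) //= scalerDl -addrA -sumrB scaler_suml; congr (_ + _).
  apply: eq_bigr => i /negPf->.
  by rewrite rmorphN mulNr scaleNr scalerDr opprD addrA subrr add0r scalerA mulrC.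
- have [i ji] := ord3_other j; have [i' ji' ii'] := ord3_third ji.
  (* These are the points where the line with equation $\sum_i l_i x_i = 0$ meets the sides through
     $e_j$. *)
  pose p a := e a + - (iota (l a) / iota (l j)) *: e j.
  have pP a : a != j -> (<[p a]>)%VS \in P.
    move=> aj; apply/(sideP _ aj); exists (- (l a / l j)).
    by rewrite rmorphN rmorphM fmorphV.
  have ij : i != j by rewrite eq_sym.
  have i'j : i' != j by rewrite eq_sym.
  exists (<[p i]> + <[p i']>)%VS.
    apply: (vlines_join hsub); rewrite ?pP //; apply/vlineP => -[c].
    move/(congr1 (fun v => crd E v i')); rewrite !crdE // eqxx (negPf ji') (negPf ii').
    by rewrite !(mulr0, addr0) => /eqP; rewrite oner_eq0.
  apply/memv_pairP; exists (crd E v i), (crd E v i').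
  rewrite [LHS](crd_sum uE v); move: s0.
  rewrite !(sum_distinct3 _ ji ji' ii') /p => s0.
  have lj0 : iota (l j) != 0 by rewrite fmorph_eq0.
  have -> : crd E v j = - (crd E v i * (iota (l i) / iota (l j))
      + crd E v i' * (iota (l i') / iota (l j))).
    apply: (mulfI lj0); apply/eqP; rewrite -subr_eq0 -s0; apply/eqP.
    by field.
  rewrite !scalerDr !scalerA !mulrN !scaleNr scalerDl.
  by rewrite addrACA -opprD [RHS]addrC addrA.
Qed.
End Framed.

(** * Tangent splashes *)

Section TangentSplash.
Variables (F : finFieldType) (n : nat) (P L : {set {vspace 'rV[F]_3}}).
Hypothesis hsub : subplane_of_order n P L.
Implicit Types (p m l T : {vspace 'rV[F]_3}).

Let ptP p : p \in P -> is_point p. Proof. exact: (subplane_point hsub). Qed.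
Let lnL m : m \in L -> is_line m. Proof. exact: (subplane_line hsub). Qed.

(** Join [T] to a vertex of a frame other than [T], then to a vertex off that first line. *)
Lemma two_lines_through T : T \in P ->
  exists m0 m1, [/\ m0 \in L, m1 \in L, m0 != m1, (T <= m0)%VS & (T <= m1)%VS].
Proof.
move=> TP; have [E fE] := exists_frame hsub; have [uE eP _] := fE.
have [i Ti] : exists i, T != <[row i E]>%VS.
  have ne : <[row 0%R E]>%VS != <[row 1%R E]>%VS.
    apply/eqP => h; have : row 0 E \in <[row 1%R E]>%VS by rewrite -h memv_line.
    case/vlineP => c /(congr1 (fun v => crd E v 0)).
    by rewrite /= !crdE // mulr0 => /eqP; rewrite oner_eq0.
  by have [->|] := eqVneq T <[row 0%R E]>%VS; [exists 1 | exists 0].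
have m0L := join_in hsub TP (eP i) Ti.
have [j ej] : exists j, row j E \notin (T + <[row i E]>)%VS.
  apply/existsP; rewrite -negb_forall; apply/negP => /forallP h.
  have : ({:'rV[F]_3} <= T + <[row i E]>)%VS.
    apply/subvP => w _; rewrite (crd_sum uE w).
    by apply: memv_suml => r _; rewrite memvZ.
  by move/dimvS; rewrite dimvf dim_matrix (eqP (lnL m0L)).
have Tj : T != <[row j E]>%VS by apply: contraNneq ej => ->; rewrite memvE addvSl.
exists (T + <[row i E]>)%VS, (T + <[row j E]>)%VS; split; rewrite ?addvSl //.
  exact: (join_in hsub).
by apply: contraNneq ej => ->; rewrite memvE addvSr.
Qed.

(** Joining a point of [m0] to a point of [m1], both other than [T], is a bijection onto these
    lines; its inverse meets a line with [m0] and [m1]. *)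
Lemma card_lines_avoiding T : T \in P -> #|[set m in L | ~~ (T <= m)%VS]| = (n * n)%N.
Proof.
move=> TP; have [m0 [m1 [m0L m1L ne T0 T1]]] := two_lines_through TP.
have m01 : (m0 :&: m1)%VS = T by apply: meet_eq; rewrite ?ptP ?lnL.
pose A m := [set p in P | (p <= m)%VS] :\ T.
have cA m : m \in L -> (T <= m)%VS -> #|A m| = n.
  move=> mL Tm; have c : #|[set p in P | (p <= m)%VS]| = n.+1.
    by case: hsub => _ _ [_]; apply.
  by move: c; rewrite (cardsD1 T) inE TP Tm add1n => -[].
have nep p p' : p \in A m0 -> p' \in A m1 -> p != p'.
  rewrite !inE => /and3P[pT pP p0] /and3P[_ _ p1]; apply: contraNneq pT => e.
  by apply/eqP/point_sub_eq; rewrite ?ptP // -m01 subv_cap p0 e.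
(* A join through [T] would be [m0] itself, which forces $p'$ into $m_0 \cap m_1 = T$. *)
have avoid p p' : p \in A m0 -> p' \in A m1 -> ~~ (T <= p + p')%VS.
  move=> hp hp'; have ne' := nep _ _ hp hp'; move: hp hp'; rewrite !inE.
  move=> /and3P[pT pP p0] /and3P[p'T p'P p1]; apply/negP => h.
  have mL := join_in hsub pP p'P ne'.
  have e0 : (p + T)%VS = (p + p')%VS by apply: join_eq; rewrite ?ptP ?lnL ?addvSl.
  have e1 : (p + T)%VS = m0 by apply: join_eq; rewrite ?ptP ?lnL.
  have p'0 : (p' <= m0)%VS by rewrite -e1 e0 addvSr.
  by case/eqP: p'T; apply: point_sub_eq; rewrite ?ptP // -m01 subv_cap p'0.
have capA p p' : p \in A m0 -> p' \in A m1 ->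
    ((p + p') :&: m0)%VS = p /\ ((p + p') :&: m1)%VS = p'.
  move=> hp hp'; have av := avoid _ _ hp hp'; have ne' := nep _ _ hp hp'.
  move: hp hp'; rewrite !inE => /and3P[pT pP p0] /and3P[p'T p'P p1].
  have mL := join_in hsub pP p'P ne'.
  by split; apply: meet_eq; rewrite ?ptP ?lnL ?addvSl ?addvSr //;
    apply: contraNneq av => ->.
rewrite -{1}(cA m0 m0L T0) -(cA m1 m1L T1) -cardsX.
rewrite -(card_in_imset (f := fun u => (u.1 + u.2)%VS)); last first.
  move=> [p p'] [r r'] /setXP[/= hp hp'] /setXP[/= hr hr'] e.
  have [e0 e1] := capA _ _ hp hp'; have [e2 e3] := capA _ _ hr hr'.
  by move: e => /= e; rewrite e in e0 e1; rewrite -e0 e2 -e1 e3.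
congr #|pred_of_set _|; apply/setP => m; rewrite !inE.
apply/andP/imsetP => [[mL Tm]|[[p p'] /setXP[/= hp hp'] ->]]; last first.
  split; last exact: avoid.
  have := nep _ _ hp hp'; move: hp hp'; rewrite !inE => /and3P[_ pP _] /and3P[_ p'P _].
  exact: (join_in hsub).
have n0 : m != m0 by apply: contraNneq Tm => ->.
have n1 : m != m1 by apply: contraNneq Tm => ->.
have h0 : (m :&: m0)%VS \in A m0.
  rewrite !inE (meet_in hsub) // capvSr !andbT.
  by apply: contraNneq Tm => <-; rewrite capvSl.
have h1 : (m :&: m1)%VS \in A m1.
  rewrite !inE (meet_in hsub) // capvSr !andbT.
  by apply: contraNneq Tm => <-; rewrite capvSl.
exists (m :&: m0, m :&: m1)%VS; first exact/setXP.
apply/esym/join_eq; rewrite ?lnL ?nep ?capvSl // ptP //.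
  exact: (meet_in hsub).
exact: (meet_in hsub).
Qed.

Lemma card_tangent_splash l : (0 < n)%N -> is_line l -> tangent_to l P ->
  #|splash l L| = (n ^ 2 + 1)%N.
Proof.
move=> n0 il /eqP/cards1P[T hT].
have [TP Tl] : T \in P /\ (T <= l)%VS.
  by have := set11 T; rewrite -hT inE => /andP.
have uT p : p \in P -> (p <= l)%VS -> p = T.
  by move=> pP pl; apply/set1P; rewrite -hT inE pP.
(* As a line of the subplane, [l] would carry $n+1 > 1$ of its points. *)
have nl m : m \in L -> m != l.
  move=> mL; apply: contraTneq n0 => e.
  have : #|[set p in P | (p <= m)%VS]| = n.+1 by case: hsub => _ _ [_]; apply.
  by rewrite e hT cards1 => -[<-].
have TI m : m \in L -> (T <= m)%VS -> (m :&: l)%VS = T.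
  by move=> mL Tm; apply: meet_eq; rewrite ?ptP ?(lnL mL) ?nl.
pose N := [set m in L | ~~ (T <= m)%VS].
(* Lines through [T] contribute [T] alone, so the count reduces to lines avoiding [T]. *)
have sE : splash l L = T |: [set (m :&: l)%VS | m in N].
  apply/setP => p; rewrite !inE; apply/and3P/orP.
    move=> [ip pl /exists_inP[m mL pm]].
    have e : (m :&: l)%VS = p by apply: meet_eq; rewrite ?(lnL mL) ?nl.
    have [Tm|Tm] := boolP (T <= m)%VS; first by left; rewrite -e TI.
    by right; apply/imsetP; exists m; rewrite ?inE ?mL.
  case=> [/eqP->|/imsetP[m]].
    have [m [_ [mL _ _ Tm _]]] := two_lines_through TP.
    by split; rewrite ?ptP //; apply/exists_inP; exists m.
  rewrite inE => /andP[mL _] ->; split; rewrite ?capvSr ?is_point_meet ?(lnL mL) ?nl //.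
  by apply/exists_inP; exists m => //; rewrite capvSl.
rewrite sE cardsU1 card_in_imset ?card_lines_avoiding //.
  rewrite mulnn addnC; congr (_ + _)%N.
  case: imsetP => // -[m]; rewrite inE => /andP[mL Tm] e.
  by case/negP: Tm; rewrite e capvSl.
(* Two lines meeting [l] in the same point meet there in a subplane point, which by tangency is
   [T]. *)
move=> m m'; rewrite !inE => /andP[mL Tm] /andP[m'L _] e.
apply: contraNeq Tm => ne.
have ip : is_point (m :&: l)%VS by rewrite is_point_meet ?(lnL mL) ?nl.
have h : (m :&: m')%VS = (m :&: l)%VS.
  by apply: meet_eq; rewrite ?lnL ?capvSl // e capvSl.
have <- : (m :&: m')%VS = T by apply: uT; rewrite ?(meet_in hsub) // h capvSr.
exact: capvSl.
Qed.
End TangentSplash.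

(** * Parametrisation of the line at infinity *)

Section InfinityLine.
Variable F : finFieldType.

Lemma memv_coords_pair (x y z a : F) :
  ((coords x y z)%R \in <[(coords a 1 0)%R]>)%VS = (z == 0) && (x == y * a).
Proof.
apply/vlineP/andP => [[c /rowP h]|[/eqP-> /eqP->]].
  move: (h 0) (h 1) (h 2); rewrite !mxE /= mulr1 mulr0 => -> -> ->.
  by rewrite !eqxx.
exists y; apply/rowP => i; rewrite !mxE.
by move: i; apply: ord3P; rewrite /= ?mulr1 ?mulr0.
Qed.

Lemma coordsZ (c x y z : F) : c *: coords x y z = coords (c * x) (c * y) (c * z).
Proof. by apply/rowP => i; rewrite !mxE; move: i; apply: ord3P. Qed.

Lemma coords_lin (x y : F) : coords x y 0 = x *: coords 1 0 0 + y *: coords 0 1 0.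
Proof.
apply/rowP => i; rewrite !mxE.
by move: i; apply: ord3P; rewrite /= ?mulr1 ?mulr0 ?addr0 ?add0r.
Qed.

Lemma memv_linfty v : reflect (exists x y, v = coords x y 0) (v \in @linfty F).
Proof.
by apply: (iffP (memv_pairP _ _ _)) => -[x [y ->]]; exists x, y; rewrite (coords_lin x y).
Qed.

Definition linfty_vec (o : option F) : 'rV[F]_3 :=
  if o is Some x then coords x 1 0 else coords 1 0 0.

Lemma linfty_pointE o : linfty_point o = <[linfty_vec o]>%VS.
Proof. by case: o. Qed.

Lemma linfty_vec_neq0 o : linfty_vec o != 0.
Proof.
apply/eqP; case: o => [x|] /rowP h; [move: (h 1) | move: (h 0)];
  by rewrite !mxE /= => /eqP; rewrite oner_eq0.
Qed.

Lemma linfty_point_inj : injective (@linfty_point F).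
Proof.
have h o : linfty_vec o \in linfty_point o by rewrite linfty_pointE memv_line.
move=> [x|] [y|] e //; last 2 first.
- by move: (h None); rewrite -e memv_coords_pair eqxx mul0r oner_eq0.
- by move: (h None); rewrite e memv_coords_pair eqxx mul0r oner_eq0.
by move: (h (Some x)); rewrite e memv_coords_pair eqxx mul1r => /eqP->.
Qed.

Lemma is_line_linfty : is_line (@linfty F).
Proof.
have n1 := linfty_vec_neq0 None; have n2 := linfty_vec_neq0 (Some 0).
apply: is_line_join; [by rewrite is_point_vline | by rewrite is_point_vline |].
apply/eqP => e; have : coords 1 0 0 \in <[(coords 0 1 (0 : F))%R]>%VS by rewrite -e memv_line.
by rewrite memv_coords_pair eqxx mul0r oner_eq0.
Qed.

(** A point spanned by $(x, y, 0)$ has parameter $x/y$, or infinity when $y = 0$. *)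
Lemma linfty_pointP p : is_point p -> (p <= @linfty F)%VS -> exists o, p = linfty_point o.
Proof.
move=> /point_vline[v v0 ->]; rewrite -memvE => /memv_linfty[x [y ve]].
have [y0|y0] := eqVneq y 0.
  exists None; move: v0; rewrite linfty_pointE ve y0.
  rewrite (coords_lin x) scale0r addr0 => v0.
  by rewrite vlineZ //; apply: contraNneq v0 => ->; rewrite scale0r.
exists (Some (x / y)); rewrite linfty_pointE -(vlineZ (linfty_vec _) y0) ve.
by rewrite coordsZ mulrC divfK // mulr1 mulr0.
Qed.

Lemma linfty_point_sub o : (linfty_point o <= @linfty F)%VS.
Proof.
rewrite linfty_pointE -memvE; apply/memv_linfty.
by case: o => [x|]; [exists x, 1 | exists 1, 0].
Qed.
End InfinityLine.

(** The frame coordinates of $(X,1,0)$ are $X a_i + b_i$, where $a$ and $b$ are those of $(1,0,0)$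
    and $(0,1,0)$; the point at infinity has coordinates $a$. Lying on a subplane line thus becomes
    the Sherk equation. *)
Lemma splash_linfty_sherk (k F : finFieldType) (iota : {rmorphism k -> F})
    (P L : {set {vspace 'rV[F]_3}}) :
  #|F| = (#|k| ^ 3)%N -> subplane_of_order #|k| P L ->
  exists (theta : k) (K M : F) (phi : k),
    splash linfty L = linfty_point @: sherk iota theta K M phi.
Proof.
move=> cF hsub; have [E fE] := exists_frame hsub.
have [theta [K [M [phi sP]]]] :=
  moore_sherk iota cF (crd E (coords 1 0 0)) (crd E (coords 0 1 0)).
exists theta, K, M, phi.
have inS o : (o \in sherk iota theta K M phi) = [exists m in L, (linfty_point o <= m)%VS].
  rewrite sP; have -> : moore k (if o is Some X then
      fun i => X * crd E (coords 1 0 0) i + crd E (coords 0 1 0) i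
      else crd E (coords 1 0 0)) = moore k (crd E (linfty_vec o)).
    case: o => //= X; rewrite (coords_lin X) scale1r.
    by rewrite /moore /triple !crdD !crdZ.
  rewrite linfty_pointE; apply/eqP/exists_inP => [/(moore_dependent iota) d|[m mL vm]].
    by have [m mL vm] := (on_lineP iota hsub fE _).2 d; exists m.
  by apply: dependent_moore; apply/(on_lineP iota hsub fE); exists m.
apply/setP => p; rewrite inE; apply/and3P/imsetP => [[ip pl pL]|[o oS ->]].
  have [o e] := linfty_pointP ip pl; exists o => //.
  by rewrite inS -e.
by rewrite -inS linfty_point_sub linfty_pointE is_point_vline linfty_vec_neq0.
Qed.

Theorem theorem8p1 (p h q : nat) (hp : prime p) (hh : (0 < h)%N)
  (hq : q = (p ^ h)%N)
  (k F : finFieldType) (iota : {rmorphism k -> F})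
  (hk : #|k| = q) (hF : #|F| = (q ^ 3)%N)
  (P L : {set {vspace 'rV[F]_3}})
  (hsub : subplane_of_order q P L)
  (htan : tangent_to linfty P) :
  exists (theta : k) (K M : F) (phi : k),
    splash linfty L = linfty_point @: sherk iota theta K M phi
    /\ #|sherk iota theta K M phi| = (q ^ 2 + 1)%N.
Proof.
have q0 : (0 < q)%N by rewrite -hk ltnW // finRing_gt1.
have [] := @splash_linfty_sherk k F iota P L; rewrite ?hk //.
move=> theta [K [M [phi e]]]; exists theta, K, M, phi; split=> //.
(* Injectivity of the parametrisation carries the size of the splash over to the Sherk surface. *)
rewrite -(card_imset _ (@linfty_point_inj F)) -e.
by rewrite (card_tangent_splash hsub) // is_line_linfty.
Qed.
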